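(* Let $ABC$ be a triangle and let $\mathcal{E}$ be the elliptic curve given in homogeneous barycentric coordinates with respect to $ABC$ by $$\mathcal{E}:\quad x^2(y+z)+y^2(x+z)+z^2(x+y)-2xyz=0 .$$ Let $\mathcal{C}$ be a circle with center $Z_1$, let $Q_1$ and $P_1'$ be points on $\mathcal{C}$ and let $O_1$ be a point such that $Q_1Z_1P_1'O_1$ is a square. Let $S_1$ be the midpoint of segment $Q_1O_1$, let $G_1=Z_1S_1\cdot Q_1P_1'$, and let $P_1$ and $Q_1'$ be the reflections of $P_1'$ and $Q_1$, respectively, in the line $G_1Z_1$. Then the set of points $$\mathcal{E}-\{A,B,C,A_\infty,B_\infty,C_\infty\}$$ coincides with the set of points $\textsf{A}(P_1)$, where $A_1$ is a point on the arc $\mathscr{A}=P_1Q_1Q_1'P_1'$ of $\mathcal{C}$ distinct from the points in $\{P_1,Q_1,Q_1',P_1'\}$, $B_1,C_1$ are the unique points on $\mathscr{A}$ for which $A_1B_1C_1$ has centroid $G_1$, and $\textsf{A}$ is an affine map for which $\textsf{A}(A_1B_1C_1)=ABC$ or $\textsf{A}(A_1C_1B_1)=ABC$.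
   Context: We work in the real Euclidean plane, extended by the line at infinity $l_\infty$ to the real projective plane; $\mathcal{E}$ is considered as its set of real points. The dot denotes intersection of lines. $A_\infty=BC\cdot l_\infty=(0,1,-1)$, $B_\infty=AC\cdot l_\infty=(1,0,-1)$, $C_\infty=AB\cdot l_\infty=(1,-1,0)$ are the infinite points on the sides of $ABC$, and $A=(1,0,0)$, $B=(0,1,0)$, $C=(0,0,1)$. The arc $\mathscr{A}=P_1Q_1Q_1'P_1'$ is the arc of $\mathcal{C}$ with endpoints $P_1$ and $P_1'$ that contains $Q_1$ and $Q_1'$. The notation $\textsf{A}(XYW)=ABC$ means $\textsf{A}(X)=A$, $\textsf{A}(Y)=B$, $\textsf{A}(W)=C$. *)

(* Defs.v *)
From HB Require Import structures.
From mathcomp Require Import all_boot all_order all_algebra.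
From mathcomp Require Import boolp classical_sets reals.

Set Implicit Arguments.
Unset Strict Implicit.
Unset Printing Implicit Defensive.

Import Order.TTheory GRing.Theory Num.Theory.

Local Open Scope classical_set_scope.
Local Open Scope ring_scope.

Section EuclideanPlane.
Variable R : realType.
Implicit Types (P Q U V X Y Z : 'rV[R]_2).

Definition dotp (u v : 'rV[R]_2) : R := \sum_i u 0 i * v 0 i.

(* The library norm on matrices is the sup norm, hence this definition. *)
Definition edist X Y : R := Num.sqrt (dotp (X - Y) (X - Y)).

(* Twice the signed area of PQX: positive when X lies to the left of the
   directed line PQ, zero when P, Q, X are collinear. *)
Definition orient P Q X : R :=
  (Q 0 0 - P 0 0) * (X 0 1 - P 0 1) - (Q 0 1 - P 0 1) * (X 0 0 - P 0 0).

Definition triangle X Y Z : Prop := orient X Y Z != 0.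

Definition midpoint X Y : 'rV[R]_2 := 2^-1 *: (X + Y).

Definition centroid X Y Z : 'rV[R]_2 := 3^-1 *: (X + Y + Z).

(* The vertices are listed in cyclic order. *)
Definition is_square P Q U V : Prop :=
  [/\ P != Q, Q - P = U - V, edist Q P = edist Q U & dotp (P - Q) (U - Q) = 0].

(* Orthogonal projection of X on the line PQ (for P != Q). *)
Definition foot P Q X : 'rV[R]_2 :=
  P + (dotp (X - P) (Q - P) / dotp (Q - P) (Q - P)) *: (Q - P).

Definition reflection P Q X : 'rV[R]_2 := 2 *: foot P Q X - X.

Definition circle Z (r : R) : set 'rV[R]_2 := [set X | edist X Z = r].

(* The line PQ cuts the circle into its two closed arcs with endpoints P, Q. *)
Definition is_arc Z (r : R) P Q (arc : set 'rV[R]_2) : Prop :=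
  [/\ P != Q, circle Z r P, circle Z r Q &
      arc = circle Z r `&` [set X | 0 <= orient P Q X] \/
      arc = circle Z r `&` [set X | orient P Q X <= 0]].

Definition affine_map (f : 'rV[R]_2 -> 'rV[R]_2) : Prop :=
  exists (M : 'M[R]_2) (b : 'rV[R]_2),
    M \in unitmx /\ forall X, f X = X *m M + b.

Definition maps_triangle (f : 'rV[R]_2 -> 'rV[R]_2) X Y Z A B C : Prop :=
  [/\ f X = A, f Y = B & f Z = C].

Definition unique_centroid_pair (arc : set 'rV[R]_2) (G X Y Z : 'rV[R]_2)
    : Prop :=
  [/\ arc Y, arc Z, centroid X Y Z = G &
      forall Y' Z', arc Y' -> arc Z' -> centroid X Y' Z' = G ->
        (Y' = Y /\ Z' = Z) \/ (Y' = Z /\ Z' = Y)].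

End EuclideanPlane.

(* The real projective plane: points and lines are the subspaces of R^3 of
   dimension 1 and 2, the Euclidean point (x, y) being spanned by (x, y, 1).
   The intersection of two distinct lines is their meet (_ :&: _)%VS. *)
Section ProjectivePlane.
Variable R : realType.
Implicit Types (A B C X Y : 'rV[R]_2).

Definition homog X : 'rV[R]_(2 + 1) := row_mx X 1%:M.

Definition ppoint X : {vspace 'rV[R]_(2 + 1)} := <[homog X]>%VS.

Definition pline X Y : {vspace 'rV[R]_(2 + 1)} := (ppoint X + ppoint Y)%VS.

Definition line_at_infinity : {vspace 'rV[R]_(2 + 1)} :=
  lker (linfun (@rsubmx R 1 2 1)).

Definition infinite_point X Y : {vspace 'rV[R]_(2 + 1)} :=
  (pline X Y :&: line_at_infinity)%VS.

(* The point with homogeneous barycentric coordinates (x : y : z) with respect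
   to ABC; it is at infinity exactly when x + y + z = 0. *)
Definition bary A B C (x y z : R) : {vspace 'rV[R]_(2 + 1)} :=
  <[x *: homog A + y *: homog B + z *: homog C]>%VS.

Definition curveE A B C : set {vspace 'rV[R]_(2 + 1)} :=
  [set P | exists x y z : R,
    [/\ (x, y, z) != (0, 0, 0),
        x ^+ 2 * (y + z) + y ^+ 2 * (x + z) + z ^+ 2 * (x + y)
          - 2 * x * y * z = 0
      & P = bary A B C x y z]].

End ProjectivePlane.

(* Main.v *)
Require Import Defs.
From HB Require Import structures.
From mathcomp Require Import all_boot all_order all_algebra.
From mathcomp Require Import boolp classical_sets reals.
From mathcomp Require Import ring lra.

Set Implicit Arguments.
Unset Strict Implicit.
Unset Printing Implicit Defensive.

Import Order.TTheory GRing.Theory Num.Theory.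

Local Open Scope classical_set_scope.
Local Open Scope ring_scope.

(** Take the orthonormal frame with origin [Z1] (and unit length [r]) in which
    [P1 = (1, 0)] and [Q1' = (0, 1)].  Then [Q1 = (4/5, 3/5)],
    [P1' = (-3/5, 4/5)], [3 G1 = (1, 2)], and the arc is the part of the unit
    circle where [1 <= a + 2 b].

    If an affine map sends [A1 B1 C1] to [ABC], the image of [P1] has the
    barycentric coordinates [(x : y : z)] of [P1] with respect to [A1 B1 C1].
    With [x + y + z = 1] and [xyz <> 0] the equation of the curve becomes
    [1/x + 1/y + 1/z = 5].  The points of the curve with [xyz = 0] are exactly
    the six excluded ones, and every point at infinity of the curve is among them
    ([curveE_affine_part]).

    Exchanging [B1] and [C1] exchanges [y] and [z] and fixes [x], and [x]
    determines [y + z] and [yz], so one expects a one-to-one correspondence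
    between [A1] and [x] alone.  It is a Moebius transformation from the real
    line to the unit circle of the complex plane, namely
    [x |-> ((4 + 3i) x - 1 - 2i) / (5x - 2 + i)], the one that sends
    [1, 0, 1/5] and infinity to [P1, Q1', P1', Q1]; its real and imaginary
    parts are [circ_x] and [circ_y].  The theorem rests on two facts.

    - If [(x, y, z)] is on the curve, the circle points with parameters
      [x, y, z] have sum [(1, 2)], hence centroid [G1], and [P1] has barycentric
      coordinates [(x, y, z)] with respect to them ([bary_cubic_sums]).
    - The height [a + 2b - 1] of the circle point with parameter [x] above
      the chord [P1 P1'] has the sign of [(5x - 1)(x - 1)] ([chord_height]),
      which is also the sign of the discriminant of the quadratic equation for
      [y] and [z] ([bary_cubic_disc]).  So the arc without the four exceptional
      points is parametrized exactly by the first coordinates of real points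
      of the curve ([param_arc], [arc_param]).

    Finally [B1] and [C1] are unit vectors with the given sum
    [3 G1 - A1 <> 0], hence unique up to order ([unit_pair_unique]): whatever
    pair [B1, C1] is chosen for [A1], it is the parametrized one. *)

(** * The rational parametrization of the circle *)

(** The squared modulus of [5t - 2 + i], divided by 5. *)
Definition circ_den (R : realType) (t : R) : R := 5 * t ^+ 2 - 4 * t + 1.

(** The complex number [((4 + 3i) t - 1 - 2i) / (5t - 2 + i)], whose numerator and
    denominator have the same modulus, is [circ_x t + i circ_y t]. *)
Definition circ_x (R : realType) (t : R) : R :=
  (4 * t ^+ 2 - 2 * t) / circ_den t.
Definition circ_y (R : realType) (t : R) : R :=
  (3 * t ^+ 2 - 4 * t + 1) / circ_den t.

Lemma circ_den_gt0 (R : realType) (t : R) : 0 < circ_den t.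
Proof.
have -> : circ_den t = ((5 * t - 2) ^+ 2 + 1) / 5 by rewrite /circ_den; field.
by rewrite divr_gt0 // ltr_wpDl ?sqr_ge0.
Qed.

Lemma circ_den_neq0 (R : realType) (t : R) : circ_den t != 0.
Proof. by rewrite gt_eqF ?circ_den_gt0. Qed.

Lemma on_unit_circle (R : realType) (t : R) : circ_x t ^+ 2 + circ_y t ^+ 2 = 1.
Proof.
by have := circ_den_neq0 t; rewrite /circ_x /circ_y /circ_den => d0; field; apply: d0.
Qed.

(** The left-hand side vanishes on the chord joining [(1, 0)] and [(-3/5, 4/5)],
    whose ends have the parameters [1] and [1/5]. *)
Lemma chord_height (R : realType) (t : R) :
  circ_x t + 2 * circ_y t - 1 = (5 * t - 1) * (t - 1) / circ_den t.
Proof.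
by have := circ_den_neq0 t; rewrite /circ_x /circ_y /circ_den => d0; field; apply: d0.
Qed.

Lemma circ_xE (R : realType) (t : R) : circ_x t * circ_den t = 4 * t ^+ 2 - 2 * t.
Proof. by rewrite /circ_x divfK ?circ_den_neq0. Qed.

Lemma circ_yE (R : realType) (t : R) : circ_y t * circ_den t = 3 * t ^+ 2 - 4 * t + 1.
Proof. by rewrite /circ_y divfK ?circ_den_neq0. Qed.

Lemma circ_xyP (R : realType) (a b t : R) :
  a * circ_den t = 4 * t ^+ 2 - 2 * t -> b * circ_den t = 3 * t ^+ 2 - 4 * t + 1 ->
  a = circ_x t /\ b = circ_y t.
Proof. by rewrite /circ_x /circ_y => <- <-; rewrite !mulfK ?circ_den_neq0. Qed.

(** The point [(4/5, 3/5)] is the value of the parametrization at infinity;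
    everywhere else the Moebius transformation is inverted. *)
Lemma circle_param_surj (R : realType) (a b : R) :
  a ^+ 2 + b ^+ 2 = 1 -> (a, b) != (4 / 5, 3 / 5) ->
  exists t : R, a = circ_x t /\ b = circ_y t.
Proof.
move=> ab1 nQ.
have m0 : 5 - 4 * a - 3 * b != 0.
  apply: contraNneq nQ => m0.
  have : (5 * a - 4) ^+ 2 + (5 * b - 3) ^+ 2 = 0.
    have -> : (5 * a - 4) ^+ 2 + (5 * b - 3) ^+ 2 =
      25 * (a ^+ 2 + b ^+ 2 - 1) + 10 * (5 - 4 * a - 3 * b) by ring.
    by rewrite ab1 m0; ring.
  move/eqP; rewrite paddr_eq0 ?sqr_ge0 // !sqrf_eq0 => /andP[/eqP h1 /eqP h2].
  by apply/eqP; congr pair; lra.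
(* The preimage of [w = a + b i] under the Moebius transformation, which is
   [((2 - i) w - 1 - 2i) / (5w - 4 - 3i)], made real with [|w| = 1]. *)
exists ((2 - a - 2 * b) / (5 - 4 * a - 3 * b)).
have ab0 : a ^+ 2 + b ^+ 2 - 1 = 0 by rewrite ab1 subrr.
apply: circ_xyP; apply/eqP; rewrite -subr_eq0; apply/eqP.
- transitivity ((a ^+ 2 + b ^+ 2 - 1) * (5 * a - 4) / (5 - 4 * a - 3 * b) ^+ 2).
    by rewrite /circ_den; field.
  by rewrite ab0 !mul0r.
- transitivity ((a ^+ 2 + b ^+ 2 - 1) * (5 * b - 3) / (5 - 4 * a - 3 * b) ^+ 2).
    by rewrite /circ_den; field.
  by rewrite ab0 !mul0r.
Qed.

(** The numerators of [circ_x] and [circ_y] and the denominator are quadratics in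
    the parameter, so this is a Vandermonde determinant times the determinant,
    up to sign 4, of the matrix of their coefficients. *)
Lemma circle_param_det (R : realType) (x y z : R) :
  (circ_x y - circ_x x) * (circ_y z - circ_y x)
    - (circ_y y - circ_y x) * (circ_x z - circ_x x) =
  4 * ((x - y) * (y - z) * (z - x)) / (circ_den x * circ_den y * circ_den z).
Proof.
have := (circ_den_neq0 x, circ_den_neq0 y, circ_den_neq0 z).
rewrite /circ_x /circ_y /circ_den => -[[dx dy] dz].
by field; rewrite dx dy dz.
Qed.

(** * The cubic in normalized barycentric coordinates *)

(** For [x y z <> 0] the second equation is [1/x + 1/y + 1/z = 5], which is the
    equation of the elliptic curve normalized by [x + y + z = 1]. *)
Definition bary_cubic (R : realType) (x y z : R) : Prop :=
  x + y + z = 1 /\ x * y + y * z + z * x = 5 * x * y * z.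

Lemma disc_factor_gt0 (R : realType) (t : R) : 0 < 5 * t ^+ 2 - 2 * t + 1.
Proof.
have -> : 5 * t ^+ 2 - 2 * t + 1 = ((5 * t - 1) ^+ 2 + 4) / 5 by field.
by rewrite divr_gt0 // ltr_wpDl ?sqr_ge0.
Qed.

Lemma bary_cubic_cycle (R : realType) (x y z : R) :
  bary_cubic x y z -> bary_cubic y z x.
Proof. by case=> h1 h2; split; [rewrite -h1|rewrite -[RHS]mulrA]; lra. Qed.

Lemma bary_cubic_swap (R : realType) (x y z : R) :
  bary_cubic x y z -> bary_cubic x z y.
Proof. by case=> h1 h2; split; lra. Qed.

(** Points with parameters [x], [y], [z] on the circle then have centroid
    [(1/3, 2/3)], and [(x, y, z)] are the barycentric coordinates of [(1, 0)] with
    respect to them.  Each equation is a polynomial identity modulo the cubic. *)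
Lemma bary_cubic_sums (R : realType) (x y z : R) : bary_cubic x y z ->
  [/\ circ_x x + circ_x y + circ_x z = 1, circ_y x + circ_y y + circ_y z = 2,
      x * circ_x x + y * circ_x y + z * circ_x z = 1
    & x * circ_y x + y * circ_y y + z * circ_y z = 0].
Proof.
case=> s1 s2.
have {s1} zE : z = 1 - x - y by lra.
have E0 : x * y + y * z + z * x - 5 * x * y * z = 0 by rewrite s2 subrr.
have := (circ_den_neq0 x, circ_den_neq0 y, circ_den_neq0 z).
rewrite /circ_x /circ_y /circ_den.
move: E0; rewrite {}zE => E0 [[dx dy] dz].
(* The four explicit polynomials [q] below are the quotients by the cubic of
   the numerators, after the substitution [z = 1 - x - y]. *)
have vanish q D v u : u - v = (x * y + y * (1 - x - y) + (1 - x - y) * x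
    - 5 * x * y * (1 - x - y)) * q / D -> u = v.
  by rewrite E0 !mul0r => /eqP; rewrite subr_eq0 => /eqP.
split.
- apply: (vanish (- 4 + 15 * y - 15 * y ^+ 2 + 15 * x - 50 * (x * y)
    + 35 * (x * y ^+ 2) - 15 * x ^+ 2 + 35 * (x ^+ 2 * y))
    (circ_den x * circ_den y * circ_den (1 - x - y))).
  by rewrite /circ_den; field; rewrite dx dy dz.
- apply: (vanish (- 2 + 5 * y - 5 * y ^+ 2 + 5 * x
    - 5 * (x * y ^+ 2) - 5 * x ^+ 2 - 5 * (x ^+ 2 * y))
    (circ_den x * circ_den y * circ_den (1 - x - y))).
  by rewrite /circ_den; field; rewrite dx dy dz.
- apply: (vanish (- 2 + 7 * y - 7 * y ^+ 2 + 7 * x - 20 * (x * y)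
    + 13 * (x * y ^+ 2) - 7 * x ^+ 2 + 13 * (x ^+ 2 * y))
    (circ_den x * circ_den y * circ_den (1 - x - y))).
  by rewrite /circ_den; field; rewrite dx dy dz.
- apply: (vanish (- y + y ^+ 2 - x + 10 * (x * y)
    - 9 * (x * y ^+ 2) + x ^+ 2 - 9 * (x ^+ 2 * y))
    (circ_den x * circ_den y * circ_den (1 - x - y))).
  by rewrite /circ_den; field; rewrite dx dy dz.
Qed.

(** From [y + z = 1 - x] and [y z (5x - 1) = x (1 - x)], the discriminant of the
    quadratic polynomial with roots [y] and [z], cleared of its denominator. *)
Lemma bary_cubic_disc (R : realType) (x y z : R) : bary_cubic x y z ->
  (y - z) ^+ 2 * (5 * x - 1) = (x - 1) * (5 * x ^+ 2 - 2 * x + 1).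
Proof.
case=> s1 s2; have zE : z = 1 - x - y by lra.
by move: s2; rewrite zE => s2; nra.
Qed.

Lemma bary_cubic_neq1 (R : realType) (x y z : R) : bary_cubic x y z ->
  x * y * z != 0 -> x != 1 /\ 5 * x != 1.
Proof.
case=> s1 s2 n0; split; apply: contraNneq n0 => h.
  have zE : z = - y by lra.
  by move: s2; rewrite h zE => s2; apply/eqP; nra.
have xE : x = 5^-1 by lra.
have zE : z = 1 - x - y by lra.
by exfalso; move: s2; rewrite zE xE => s2; lra.
Qed.

(** By [bary_cubic_disc], [y = z] forces [x = 1], whose only solutions lie on the
    side lines. *)
Lemma bary_cubic_neq (R : realType) (x y z : R) : bary_cubic x y z ->
  x * y * z != 0 -> y != z.
Proof.
move=> Exyz n0; have [x1 _] := bary_cubic_neq1 Exyz n0.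
apply: contra_neq x1 => yz; have := bary_cubic_disc Exyz.
rewrite yz subrr expr0n mul0r => /esym /eqP; rewrite mulf_eq0.
by rewrite [X in _ || X]gt_eqF ?disc_factor_gt0 // orbF subr_eq0 => /eqP.
Qed.

(** In [bary_cubic_disc] the square on the left and the quadratic factor on the
    right are positive, so the other two factors have the same sign. *)
Lemma bary_cubic_arc (R : realType) (x y z : R) : bary_cubic x y z ->
  x * y * z != 0 -> 0 < (5 * x - 1) * (x - 1).
Proof.
move=> Exyz n0; have [x1 x5] := bary_cubic_neq1 Exyz n0.
have yz := bary_cubic_neq Exyz n0; have D := bary_cubic_disc Exyz.
have q0 := disc_factor_gt0 x.
have s0 : 0 < (y - z) ^+ 2 by rewrite exprn_even_gt0 //= subr_eq0.
rewrite -(pmulr_rgt0 _ s0) mulrA D mulrAC -expr2.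
by rewrite mulr_gt0 // exprn_even_gt0 //= subr_eq0.
Qed.

(** The converse of [bary_cubic_arc]: the quadratic equation for [y] and [z] has a
    positive discriminant. *)
Lemma bary_cubic_split (R : realType) (x : R) :
  x != 0 -> 0 < (5 * x - 1) * (x - 1) ->
  exists y z : R, bary_cubic x y z /\ x * y * z != 0.
Proof.
move=> x0 hx.
have x5 : 5 * x - 1 != 0 by apply: contraTneq hx => ->; rewrite mul0r ltxx.
have x1 : x - 1 != 0 by apply: contraTneq hx => ->; rewrite mulr0 ltxx.
pose D := (x - 1) * (5 * x ^+ 2 - 2 * x + 1) / (5 * x - 1).
have D0 : 0 <= D.
  have -> : D = (5 * x - 1) * (x - 1) * (5 * x ^+ 2 - 2 * x + 1)
    / (5 * x - 1) ^+ 2 by rewrite /D; field.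
  by rewrite divr_ge0 ?sqr_ge0 // mulr_ge0 ?(ltW hx) // ltW ?disc_factor_gt0.
have sD := sqr_sqrtr D0; set s := Num.sqrt D in sD.
exists ((1 - x + s) / 2), ((1 - x - s) / 2).
have yz : (1 - x + s) / 2 * ((1 - x - s) / 2) = x * (1 - x) / (5 * x - 1).
  transitivity (((1 - x) ^+ 2 - s ^+ 2) / 4); first by field.
  by rewrite sD /D; field.
split; last first.
  rewrite -mulrA yz !mulf_neq0 ?invr_eq0 //.
  by rewrite -opprB oppr_eq0.
split; first by field.
rewrite -[RHS]mulrA yz.
by field.
Qed.

Lemma bary_cubic_height_gt0 (R : realType) (x y z : R) : bary_cubic x y z ->
  x * y * z != 0 -> 1 < circ_x x + 2 * circ_y x.
Proof.
move=> Exyz n0; rewrite -subr_gt0 chord_height divr_gt0 ?circ_den_gt0 //.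
exact: bary_cubic_arc Exyz n0.
Qed.

(** * Pairs of unit vectors with a given sum *)

(** Let [u + v = y + z = w] with unit vectors.  Expanding [|y + z - u| = 1] gives
    [(u - y).(u - z) = 0], and [u.w = y.w = z.w] makes both factors orthogonal
    to [w <> 0], hence parallel.  Two vectors of the plane that are parallel and
    orthogonal cannot both be nonzero. *)
Lemma unit_pair_unique (R : realType) (y1 y2 z1 z2 u1 u2 v1 v2 : R) :
  y1 ^+ 2 + y2 ^+ 2 = 1 -> z1 ^+ 2 + z2 ^+ 2 = 1 ->
  u1 ^+ 2 + u2 ^+ 2 = 1 -> v1 ^+ 2 + v2 ^+ 2 = 1 ->
  u1 + v1 = y1 + z1 -> u2 + v2 = y2 + z2 -> (y1 + z1, y2 + z2) != (0, 0) ->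
  [/\ u1 = y1, u2 = y2, v1 = z1 & v2 = z2] \/
  [/\ u1 = z1, u2 = z2, v1 = y1 & v2 = y2].
Proof.
move=> hy hz hu hv s1 s2 nW.
have v1E : v1 = y1 + z1 - u1 by lra.
have v2E : v2 = y2 + z2 - u2 by lra.
have dot0 : (u1 - y1) * (u1 - z1) + (u2 - y2) * (u2 - z2) = 0.
  by move: hv; rewrite v1E v2E; nra.
have perpy : (u1 - y1) * (y1 + z1) + (u2 - y2) * (y2 + z2) = 0 by nra.
have perpz : (u1 - z1) * (y1 + z1) + (u2 - z2) * (y2 + z2) = 0 by nra.
have cross0 : (u1 - y1) * (u2 - z2) - (u2 - y2) * (u1 - z1) = 0.
  have k1 : ((u1 - y1) * (u2 - z2) - (u2 - y2) * (u1 - z1)) * (y1 + z1) = 0.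
    transitivity (((u1 - y1) * (y1 + z1) + (u2 - y2) * (y2 + z2)) * (u2 - z2)
      - (u2 - y2) * ((u1 - z1) * (y1 + z1) + (u2 - z2) * (y2 + z2))).
      by ring.
    by rewrite perpy perpz mul0r mulr0 subrr.
  have k2 : ((u1 - y1) * (u2 - z2) - (u2 - y2) * (u1 - z1)) * (y2 + z2) = 0.
    transitivity (- ((u1 - y1) * (y1 + z1) + (u2 - y2) * (y2 + z2)) * (u1 - z1)
      + (u1 - y1) * ((u1 - z1) * (y1 + z1) + (u2 - z2) * (y2 + z2))).
      by ring.
    by rewrite perpy perpz oppr0 mul0r mulr0 addr0.
  apply/eqP; apply: contraNT nW => c0; move/eqP: k1; move/eqP: k2.
  by rewrite !mulf_eq0 (negbTE c0) /= => /eqP -> /eqP ->.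
have : ((u1 - y1) ^+ 2 + (u2 - y2) ^+ 2) * ((u1 - z1) ^+ 2 + (u2 - z2) ^+ 2) = 0.
  transitivity (((u1 - y1) * (u1 - z1) + (u2 - y2) * (u2 - z2)) ^+ 2 +
    ((u1 - y1) * (u2 - z2) - (u2 - y2) * (u1 - z1)) ^+ 2); first by ring.
  by rewrite dot0 cross0 expr0n addr0.
move/eqP; rewrite mulf_eq0 => /orP[]; rewrite paddr_eq0 ?sqr_ge0 // !sqrf_eq0 !subr_eq0;
  move=> /andP[/eqP h1 /eqP h2]; [left|right]; split; lra.
Qed.

(** * Orthogonal frames of the plane *)

Lemma row2P (R : realType) (X Y : 'rV[R]_2) :
  X 0 0 = Y 0 0 -> X 0 1 = Y 0 1 -> X = Y.
Proof.
move=> h0 h1; apply/matrixP => i j; rewrite (ord1 i).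
by case: j => [[|[|//]] h]; [rewrite (_ : Ordinal h = 0)|rewrite (_ : Ordinal h = 1)];
  rewrite ?h0 ?h1 //; apply: val_inj.
Qed.

Lemma dotpE (R : realType) (u v : 'rV[R]_2) :
  dotp u v = u 0 0 * v 0 0 + u 0 1 * v 0 1.
Proof.
rewrite /dotp !big_ord_recl big_ord0 addr0.
by rewrite (_ : lift ord0 ord0 = 1) //; apply: val_inj.
Qed.

Definition cross (R : realType) (u v : 'rV[R]_2) : R :=
  u 0 0 * v 0 1 - u 0 1 * v 0 0.

Definition frame_point (R : realType) (O e f : 'rV[R]_2) (a b : R) :=
  O + a *: e + b *: f.

Definition orthogonal_frame (R : realType) (r : R) (e f : 'rV[R]_2) : Prop :=
  [/\ dotp e e = r ^+ 2, dotp f f = r ^+ 2 & dotp e f = 0].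

Lemma frame_cross_neq0 (R : realType) (r : R) (e f : 'rV[R]_2) :
  0 < r -> orthogonal_frame r e f -> cross e f != 0.
Proof.
move=> r0 [ee ff ef]; rewrite -sqrf_eq0.
have -> : cross e f ^+ 2 = dotp e e * dotp f f - dotp e f ^+ 2.
  by rewrite !dotpE /cross; ring.
by rewrite ee ff ef expr0n subr0 mulf_neq0 // expf_neq0 ?gt_eqF.
Qed.

Lemma frame_point_surj (R : realType) (O e f X : 'rV[R]_2) :
  cross e f != 0 -> exists a b, X = frame_point O e f a b.
Proof.
move=> c0; exists (cross (X - O) f / cross e f), (cross e (X - O) / cross e f).
by move: c0; rewrite /cross => c0; apply: row2P; rewrite !mxE; field.
Qed.

Lemma orient_frame (R : realType) (O e f : 'rV[R]_2) (a b c d g h : R) :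
  orient (frame_point O e f a b) (frame_point O e f c d) (frame_point O e f g h)
  = ((c - a) * (h - b) - (d - b) * (g - a)) * cross e f.
Proof. by rewrite /orient /frame_point /cross !mxE; ring. Qed.

Lemma frame_point_inj (R : realType) (O e f : 'rV[R]_2) (a b c d : R) :
  cross e f != 0 -> frame_point O e f a b = frame_point O e f c d ->
  a = c /\ b = d.
Proof.
move=> c0 h.
have := congr1 (fun X => cross (X - O) f) h.
have := congr1 (fun X => cross e (X - O)) h.
have E g k : cross (frame_point O e f g k - O) f = g * cross e f.
  by rewrite /cross /frame_point !mxE; ring.
have F g k : cross e (frame_point O e f g k - O) = k * cross e f.
  by rewrite /cross /frame_point !mxE; ring.
by rewrite !E !F => /(mulIf c0) -> /(mulIf c0) ->.
Qed.

Lemma circle_frame (R : realType) (r : R) (O e f : 'rV[R]_2) (a b : R) :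
  0 < r -> orthogonal_frame r e f ->
  circle O r (frame_point O e f a b) <-> a ^+ 2 + b ^+ 2 = 1.
Proof.
move=> r0 [ee ff ef]; rewrite /circle /= /edist.
have -> : dotp (frame_point O e f a b - O) (frame_point O e f a b - O) =
    (a ^+ 2 + b ^+ 2) * r ^+ 2.
  transitivity (a ^+ 2 * dotp e e + b ^+ 2 * dotp f f + 2 * a * b * dotp e f).
    by rewrite !dotpE /frame_point !mxE; ring.
  by rewrite ee ff ef; ring.
rewrite sqrtrM ?addr_ge0 ?sqr_ge0 // sqrtr_sqr gtr0_norm //.
split=> [|->]; last by rewrite sqrtr1 mul1r.
rewrite -[in RHS](mul1r r) => /(mulIf (lt0r_neq0 r0)) h.
by rewrite -(sqr_sqrtr (_ : 0 <= a ^+ 2 + b ^+ 2)) ?addr_ge0 ?sqr_ge0 // h expr1n.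
Qed.

Lemma centroid_frame (R : realType) (O e f : 'rV[R]_2) (a b c d g h : R) :
  centroid (frame_point O e f a b) (frame_point O e f c d) (frame_point O e f g h)
  = frame_point O e f ((a + c + g) / 3) ((b + d + h) / 3).
Proof. by apply: row2P; rewrite /centroid /frame_point !mxE; field. Qed.

(** * Affine maps *)

Lemma bary_unique (R : realType) (A B C : 'rV[R]_2) (x y z x' y' z' : R) :
  triangle A B C -> x + y + z = 1 -> x' + y' + z' = 1 ->
  x *: A + y *: B + z *: C = x' *: A + y' *: B + z' *: C ->
  [/\ x = x', y = y' & z = z'].
Proof.
move=> t s s' h.
have zE : z = 1 - x - y by lra.
have zE' : z' = 1 - x' - y' by lra.
have h0 := congr1 (orient A C) h; have h1 := congr1 (orient A B) h.
have E x1 y1 : orient A C (x1 *: A + y1 *: B + (1 - x1 - y1) *: C) =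
   - y1 * orient A B C by rewrite /orient !mxE; ring.
have F x1 y1 : orient A B (x1 *: A + y1 *: B + (1 - x1 - y1) *: C) =
   (1 - x1 - y1) * orient A B C by rewrite /orient !mxE; ring.
move: h0 h1; rewrite {1}zE {1}zE' !E {1}zE {1}zE' !F.
move=> /(mulIf t) hy /(mulIf t) hz.
by split; lra.
Qed.

Lemma affine_bary (R : realType) (f : 'rV[R]_2 -> 'rV[R]_2) (A B C : 'rV[R]_2) (x y z : R) :
  affine_map f -> x + y + z = 1 ->
  f (x *: A + y *: B + z *: C) = x *: f A + y *: f B + z *: f C.
Proof.
case=> M [b [_ fE]] s; rewrite !fE !mulmxDl -!scalemxAl !scalerDr.
rewrite [in LHS](_ : b = (x + y + z) *: b); last by rewrite s scale1r.
by rewrite !scalerDl; apply: row2P; rewrite !mxE; ring.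
Qed.

(** The linear part is the quotient of the two matrices of edge vectors, which are
    invertible because their determinants are the orientations. *)
Lemma affine_map_exists (R : realType) (X Y Z A B C : 'rV[R]_2) :
  triangle X Y Z -> triangle A B C ->
  exists f, affine_map f /\ maps_triangle f X Y Z A B C.
Proof.
move=> tX tA.
pose T (U V W : 'rV[R]_2) := col_mx (V - U) (W - U) : 'M[R]_2.
have T0 (U V W : 'rV[R]_2) j : T U V W 0 j = V 0 j - U 0 j.
  transitivity (T U V W (lshift 1 (0 : 'I_1)) j); last first.
    by apply: (etrans (col_mxEu (V - U) (W - U) (0 : 'I_1) j)); rewrite !mxE.
  by congr (T U V W _ j); apply: val_inj.
have T1 (U V W : 'rV[R]_2) j : T U V W 1 j = W 0 j - U 0 j.
  transitivity (T U V W (rshift 1 (0 : 'I_1)) j); last first.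
    by apply: (etrans (col_mxEd (V - U) (W - U) (0 : 'I_1) j)); rewrite !mxE.
  by congr (T U V W _ j); apply: val_inj.
have Tunit (U V W : 'rV[R]_2) : triangle U V W -> T U V W \in unitmx.
  move=> h; suff detT : \det (T U V W) = orient U V W.
    by rewrite unitmxE detT unitfE; apply: h.
  rewrite (expand_det_row _ 0) big_ord_recl big_ord1 /cofactor !det_mx11.
  have minorE (N : 'M[R]_2) i j :
    row' i (col' j N) (0 : 'I_1) (0 : 'I_1) = N (lift i 0) (lift j 0).
    by rewrite !mxE.
  have l0 : lift (0 : 'I_2) (0 : 'I_1) = 1 by apply: val_inj.
  have l1 : lift (1 : 'I_2) (0 : 'I_1) = 0 by apply: val_inj.
  rewrite !minorE !l0 l1 !T0 !T1 /orient /= expr0 expr1; ring.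
have rowT (U V W : 'rV[R]_2) (M : 'M[R]_2) (U' V' W' : 'rV[R]_2) :
    T U V W *m M = T U' V' W' ->
    (V - U) *m M = V' - U' /\ (W - U) *m M = W' - U'.
  move=> TM; apply: eq_col_mx; rewrite -mul_col_mx; exact: TM.
pose M := invmx (T X Y Z) *m T A B C.
have TM : T X Y Z *m M = T A B C by rewrite mulmxA mulmxV ?mul1mx ?Tunit.
have [MY MZ] := rowT _ _ _ _ _ _ _ TM.
exists (fun P => P *m M + (A - X *m M)); split.
  exists M, (A - X *m M); split => //.
  by rewrite unitmx_mul unitmx_inv !Tunit.
split.
- by rewrite addrC subrK.
- by rewrite addrCA -mulmxBl MY addrC subrK.
- by rewrite addrCA -mulmxBl MZ addrC subrK.
Qed.

(** * Points at infinity and the curve in the projective plane *)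

Lemma homog_comb (R : realType) (A B C : 'rV[R]_2) (x y z : R) :
  x *: homog A + y *: homog B + z *: homog C =
  row_mx (x *: A + y *: B + z *: C) (x + y + z)%:M.
Proof.
by rewrite /homog !scale_row_mx !add_row_mx !scale_scalar_mx !mulr1 -!raddfD.
Qed.

Lemma ppoint_inj (R : realType) (X Y : 'rV[R]_2) : ppoint X = ppoint Y -> X = Y.
Proof.
move=> h; have : homog X \in ppoint Y by rewrite -h memv_line.
case/vlineP => k; rewrite /homog scale_row_mx scale_scalar_mx mulr1.
case/eq_row_mx => XE /matrixP /(_ 0 0); rewrite !mxE !mulr1n => kE.
by rewrite XE -kE scale1r.
Qed.

Lemma bary_ppoint (R : realType) (A B C : 'rV[R]_2) (x y z : R) :
  x + y + z = 1 -> bary A B C x y z = ppoint (x *: A + y *: B + z *: C).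
Proof. by move=> s1; rewrite /bary homog_comb s1. Qed.

Lemma vline_scale (R : realType) (k : R) (v : 'rV[R]_(2 + 1)) :
  k != 0 -> <[k *: v]>%VS = <[v]>%VS.
Proof.
move=> k0; apply/eqP; rewrite eqEsubv -!memvE memvZ ?memv_line //=.
by apply/vlineP; exists k^-1; rewrite scalerA mulVf // scale1r.
Qed.

Lemma bary_scale (R : realType) (A B C : 'rV[R]_2) (k x y z : R) :
  k != 0 -> bary A B C (k * x) (k * y) (k * z) = bary A B C x y z.
Proof. by move=> k0; rewrite /bary -!scalerA -!scalerDr vline_scale. Qed.

Lemma mem_line_at_infinity (R : realType) (v : 'rV[R]_(2 + 1)) :
  (v \in line_at_infinity R) = (rsubmx v == 0).
Proof. by rewrite /line_at_infinity memv_ker lfunE. Qed.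

Lemma infinite_pointE (R : realType) (X Y : 'rV[R]_2) :
  infinite_point X Y = <[homog X - homog Y]>%VS.
Proof.
apply/eqP; rewrite eqEsubv; apply/andP; split; last first.
  rewrite -memvE memv_cap mem_line_at_infinity.
  rewrite memv_add ?memv_line ?memvN ?memv_line //=.
  by rewrite linearB /= !row_mxKr subrr.
apply/subvP => v; rewrite memv_cap mem_line_at_infinity => /andP[].
case/memv_addP => _ /vlineP[b ->] [_ /vlineP[c ->] ->].
rewrite linearD !linearZ /= !row_mxKr !scale_scalar_mx !mulr1 -raddfD /=.
move/eqP/matrixP => /(_ 0 0); rewrite !mxE mulr1n => /eqP.
rewrite addr_eq0 => /eqP ->.
by apply/vlineP; exists (- c); rewrite scalerBr !scaleNr opprK.
Qed.

Lemma ppoint_neq_infinite (R : realType) (P X Y : 'rV[R]_2) :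
  ppoint P != infinite_point X Y.
Proof.
apply/eqP => h; have : homog P \in infinite_point X Y by rewrite -h memv_line.
rewrite memv_cap mem_line_at_infinity row_mxKr => /andP[_ /eqP/matrixP /(_ 0 0)].
by rewrite !mxE => /eqP; rewrite oner_eq0.
Qed.

(** On the curve, [x = 0] leaves [y z (y + z) = 0], that is [B], [C] or the infinite
    point of [BC].  If [x + y + z = 0], the equation reduces to [5 x y z = 0].  So
    outside the six points all of [x], [y], [z] and their sum are nonzero, and
    the coordinates can be normalized. *)
Lemma curveE_affine_part (R : realType) (A B C : 'rV[R]_2) :
  triangle A B C ->
  curveE A B C `\` [set ppoint A; ppoint B; ppoint C;
                        infinite_point B C; infinite_point A C;
                        infinite_point A B] =
  [set P | exists x y z : R, [/\ bary_cubic x y z, x * y * z != 0 &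
                                 P = ppoint (x *: A + y *: B + z *: C)]].
Proof.
move=> tABC; apply/seteqP; split=> P /=.
  case=> -[x [y [z [n0 cub ->]]]] out.
  have xyz0 : x * y * z != 0.
    apply/negP => /eqP xyz0; apply: out.
    have zeros : [\/ y = 0 /\ z = 0, x = 0 /\ z = 0 | x = 0 /\ y = 0] \/
        [\/ x = 0 /\ z = - y, y = 0 /\ z = - x | z = 0 /\ y = - x].
      move/eqP: xyz0; rewrite !mulf_eq0 -orbA => /or3P[] /eqP h;
        move: cub; rewrite h => cub.
      - have /eqP : y * z * (y + z) = 0 by nra.
        rewrite !mulf_eq0 -orbA => /or3P[] /eqP k; first by left; constructor 3.
          by left; constructor 2.
        by right; constructor 1; split=> //; lra.
      - have /eqP : x * z * (x + z) = 0 by nra.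
        rewrite !mulf_eq0 -orbA => /or3P[] /eqP k; first by left; constructor 3.
          by left; constructor 1.
        by right; constructor 2; split=> //; lra.
      - have /eqP : x * y * (x + y) = 0 by nra.
        rewrite !mulf_eq0 -orbA => /or3P[] /eqP k; first by left; constructor 2.
          by left; constructor 1.
        by right; constructor 3; split=> //; lra.
    rewrite !infinite_pointE /bary.
    have nz (k : R) : (k = 0 -> (x, y, z) = (0, 0, 0)) -> k != 0.
      by move=> h; apply: contraNneq n0 => /h ->.
    case: zeros => -[[h k]|[h k]|[h k]]; move: nz; rewrite h k => nz;
      rewrite ?scale0r ?add0r ?addr0 ?scaleNr -?scalerBr vline_scale;
      by [|tauto|apply: nz => ->; rewrite ?oppr0].
  have s0 : x + y + z != 0.
    apply: contraNneq xyz0 => s0; have zE : z = - x - y by lra.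
    by move: cub; rewrite zE => cub; apply/eqP; nra.
  exists (x / (x + y + z)), (y / (x + y + z)), (z / (x + y + z)).
  have s1 : x / (x + y + z) + y / (x + y + z) + z / (x + y + z) = 1 by field.
  split.
  - split=> //; apply/eqP; rewrite -subr_eq0; apply/eqP.
    transitivity ((x ^+ 2 * (y + z) + y ^+ 2 * (x + z) + z ^+ 2 * (x + y)
      - 2 * x * y * z) / (x + y + z) ^+ 3); first by field.
    by rewrite cub mul0r.
  - by rewrite !mulf_neq0 ?invr_eq0 //; move: xyz0; rewrite !mulf_eq0 !negb_or -andbA => /and3P[].
  - rewrite -bary_ppoint // -[RHS](@bary_scale _ _ _ _ (x + y + z)) //.
    have sK k : (x + y + z) * (k / (x + y + z)) = k by field.
    by rewrite !sK.
case=> x [y [z [[s1 s2] xyz0 ->]]]; split.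
  exists x, y, z; split.
  - by apply: contraNneq xyz0 => -[-> _ _]; rewrite !mul0r.
  - transitivity ((x + y + z) * (x * y + y * z + z * x) - 5 * x * y * z).
      by ring.
    by rewrite s1 mul1r s2 subrr.
  - by rewrite bary_ppoint.
have vertex x' y' z' : x' + y' + z' = 1 -> x' * y' * z' = 0 ->
    ppoint (x *: A + y *: B + z *: C) = ppoint (x' *: A + y' *: B + z' *: C) ->
    False.
  move=> s' p' /ppoint_inj h; have [hx hy hz] := bary_unique tABC s1 s' h.
  by move: xyz0; rewrite hx hy hz p' eqxx.
have inf X Y : ppoint (x *: A + y *: B + z *: C) <> infinite_point X Y.
  exact/eqP/ppoint_neq_infinite.
case=> [[[[[]|]|]|]|]; try exact: inf.
- by move=> h; apply: (vertex 1 0 0); rewrite ?h ?scale0r ?scale1r ?mulr0 ?mul0r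
    ?addr0 ?add0r.
- by move=> h; apply: (vertex 0 1 0); rewrite ?h ?scale0r ?scale1r ?mulr0 ?mul0r
    ?addr0 ?add0r.
- by move=> h; apply: (vertex 0 0 1); rewrite ?h ?scale0r ?scale1r ?mulr0 ?mul0r
    ?addr0 ?add0r.
Qed.

(** * The configuration in its frame *)

(** In terms of [u = Q1 - Z1] and [v = P1' - Z1], which are orthogonal of
    length [r], the point [S1] is [Z1 + u + v/2], so [G1 = Z1 + (2u + v)/3].
    Reflection in the line [G1 Z1] sends [v] to [(4u - 3v)/5] and [u] to
    [(3u + 4v)/5]; these two images are taken as the frame. *)
Lemma configuration_frame (R : realType) (Z1 : 'rV[R]_2) (r : R) (hr : 0 < r)
    (Q1 P1' O1 G1 : 'rV[R]_2) :
  circle Z1 r Q1 -> circle Z1 r P1' -> is_square Q1 Z1 P1' O1 ->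
  ppoint G1 = (pline Z1 (midpoint Q1 O1) :&: pline Q1 P1')%VS ->
  exists e f : 'rV[R]_2, orthogonal_frame r e f /\
   [/\ Q1 = frame_point Z1 e f (4 / 5) (3 / 5),
       P1' = frame_point Z1 e f (- 3 / 5) (4 / 5),
       G1 = frame_point Z1 e f (1 / 3) (2 / 3),
       reflection G1 Z1 P1' = frame_point Z1 e f 1 0
     & reflection G1 Z1 Q1 = frame_point Z1 e f 0 1].
Proof.
move=> hQ hP [_ sq _ perp] hG.
have normE X : circle Z1 r X -> dotp (X - Z1) (X - Z1) = r ^+ 2.
  move=> <-; rewrite sqr_sqrtr // dotpE.
  by rewrite -!expr2 addr_ge0 ?sqr_ge0.
pose u := Q1 - Z1; pose v := P1' - Z1.
have uu : dotp u u = r ^+ 2 := normE _ hQ.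
have vv : dotp v v = r ^+ 2 := normE _ hP.
have uv : dotp u v = 0 := perp.
pose e := (4 / 5) *: u - (3 / 5) *: v; pose f := (3 / 5) *: u + (4 / 5) *: v.
have OE : O1 = P1' - (Z1 - Q1) by rewrite sq opprB addrC subrK.
have rr : r ^+ 2 != 0 by rewrite expf_neq0 ?gt_eqF.
have oef : orthogonal_frame r e f.
  split.
  - transitivity ((16 / 25) * dotp u u + (9 / 25) * dotp v v
      - (24 / 25) * dotp u v); first by rewrite !dotpE !mxE; field.
    by rewrite uu vv uv; field.
  - transitivity ((9 / 25) * dotp u u + (16 / 25) * dotp v v
      + (24 / 25) * dotp u v); first by rewrite !dotpE !mxE; field.
    by rewrite uu vv uv; field.
  - transitivity ((12 / 25) * (dotp u u - dotp v v)
      + (7 / 25) * dotp u v); first by rewrite !dotpE !mxE; field.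
    by rewrite uu vv uv; field.
have c0 := frame_cross_neq0 hr oef.
have QE : Q1 = frame_point Z1 e f (4 / 5) (3 / 5).
  by apply: row2P; rewrite !mxE; field.
have PE : P1' = frame_point Z1 e f (- 3 / 5) (4 / 5).
  by apply: row2P; rewrite !mxE; field.
have GE : G1 = frame_point Z1 e f (1 / 3) (2 / 3).
  have on_line X Y : (ppoint G1 <= pline X Y)%VS ->
      exists t, G1 = (1 - t) *: X + t *: Y.
    rewrite -memvE => /memv_addP[_ /vlineP[b ->] [_ /vlineP[c ->]]].
    rewrite /homog !scale_row_mx !scale_scalar_mx !mulr1 add_row_mx -raddfD /=.
    case/eq_row_mx => -> /matrixP /(_ 0 0); rewrite !mxE !mulr1n => s.
    by exists c; rewrite s addrK.
  (* Comparing the parameters of [G1] on its two lines. *)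
  have [s Gs] := on_line _ _ (eq_ind_r (fun V => (V <= _)%VS) (capvSl _ _) hG).
  have [t Gt] := on_line _ _ (eq_ind_r (fun V => (V <= _)%VS) (capvSr _ _) hG).
  have ms : G1 = frame_point Z1 e f (s / 2) s.
    by rewrite Gs /midpoint OE; apply: row2P; rewrite !mxE; field.
  have mt : G1 = frame_point Z1 e f (4 / 5 - 7 / 5 * t) (3 / 5 + t / 5).
    by rewrite Gt; apply: row2P; rewrite !mxE; field.
  have [k1 k2] := frame_point_inj c0 (etrans (esym ms) mt).
  by rewrite ms; congr frame_point; lra.
(* From here on only the orthogonality of the frame matters. *)
clearbody e f.
have dotf a b c d : dotp (a *: e + b *: f) (c *: e + d *: f) =
    (a * c + b * d) * r ^+ 2.
  case: oef => ee ff ef.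
  transitivity (a * c * dotp e e + b * d * dotp f f + (a * d + b * c) * dotp e f).
    by rewrite !dotpE !mxE; ring.
  by rewrite ee ff ef; ring.
have reflE a b : reflection G1 Z1 (frame_point Z1 e f a b) = frame_point Z1 e f
    ((4 * b - 3 * a) / 5) ((4 * a + 3 * b) / 5).
  have GZ : Z1 - G1 = (- 1 / 3) *: e + (- 2 / 3) *: f.
    by rewrite GE; apply: row2P; rewrite !mxE; field.
  have GX : frame_point Z1 e f a b - G1 = (a - 1 / 3) *: e + (b - 2 / 3) *: f.
    by rewrite GE; apply: row2P; rewrite !mxE; field.
  rewrite /reflection /foot GZ GX !dotf -mulf_div divff // mulr1 GE /frame_point.
  by apply: row2P; rewrite !mxE; field.
exists e, f; split=> //; split=> //.
- by rewrite [in LHS]PE reflE; congr frame_point; lra.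
- by rewrite [in LHS]QE reflE; congr frame_point; lra.
Qed.

(** Both closed half planes of the chord are possible in [is_arc]; containing the
    point [(0, 1)], which is off the chord, selects the right one whatever the
    orientation of the frame. *)
Lemma arc_frame (R : realType) (Z1 e f : 'rV[R]_2) (r : R)
    (arc : set 'rV[R]_2) : 0 < r -> orthogonal_frame r e f ->
  is_arc Z1 r (frame_point Z1 e f 1 0) (frame_point Z1 e f (- 3 / 5) (4 / 5)) arc ->
  arc (frame_point Z1 e f 0 1) ->
  forall a b, arc (frame_point Z1 e f a b) <->
    a ^+ 2 + b ^+ 2 = 1 /\ 1 <= a + 2 * b.
Proof.
move=> r0 oef [_ _ _ arcE] arcQ a b.
have c0 := frame_cross_neq0 r0 oef.
have orE a' b' : orient (frame_point Z1 e f 1 0)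
    (frame_point Z1 e f (- 3 / 5) (4 / 5)) (frame_point Z1 e f a' b')
    = - (4 / 5 * (a' + 2 * b' - 1)) * cross e f.
  by rewrite orient_frame; field.
have cf := circle_frame Z1 a b r0 oef.
case: arcE arcQ => -> [_ /=]; rewrite /setI /= !orE => side.
- have cneg : cross e f < 0 by rewrite lt_neqAle c0 /=; lra.
  rewrite nmulr_lge0 //; split=> -[/cf h1 h2]; split; try exact: h1; lra.
- have cpos : 0 < cross e f by rewrite lt_neqAle eq_sym c0 /=; lra.
  rewrite pmulr_lle0 //; split=> -[/cf h1 h2]; split; try exact: h1; lra.
Qed.

(** * Triangles inscribed in the arc *)

Section FrameArc.
Variables (R : realType) (O e f : 'rV[R]_2) (arc : set 'rV[R]_2).
Hypothesis c0 : cross e f != 0.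
Hypothesis arcE : forall a b, arc (frame_point O e f a b) <->
  a ^+ 2 + b ^+ 2 = 1 /\ 1 <= a + 2 * b.

Let pt (t : R) := frame_point O e f (circ_x t) (circ_y t).
Let exceptional := [:: frame_point O e f 1 0; frame_point O e f (4 / 5) (3 / 5);
  frame_point O e f 0 1; frame_point O e f (- 3 / 5) (4 / 5)].

(** The ends of the arc are on its chord, whereas the point with parameter [x] is
    strictly above it; [(4/5, 3/5)] is only attained at infinity and [(0, 1)]
    only at [x = 0]. *)
Lemma param_arc (x y z : R) : bary_cubic x y z -> x * y * z != 0 ->
  arc (pt x) /\ pt x \notin exceptional.
Proof.
move=> Exyz n0; have h := bary_cubic_height_gt0 Exyz n0; split.
  by apply/arcE; split; [exact: on_unit_circle|exact: ltW].
have x0 : x != 0 by apply: contraNneq n0 => ->; rewrite !mul0r.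
have ne a b : (circ_x x = a -> circ_y x = b -> False) -> pt x == frame_point O e f a b = false.
  by move=> k; apply/eqP => /(frame_point_inj c0)[]; exact: k.
rewrite !inE !ne // => ha hb; have := circ_yE x; have := circ_xE x; rewrite ha hb /circ_den.
- by lra.
- by move=> _ k; case/eqP: x0; nra.
- by move=> k l; lra.
- by lra.
Qed.

(** The excluded points are those with parameters [1], [0], [1/5] and infinity;
    elsewhere on the arc [(5x - 1)(x - 1)] is positive. *)
Lemma arc_param (A : 'rV[R]_2) : arc A -> A \notin exceptional ->
  exists x y z, [/\ bary_cubic x y z, x * y * z != 0 & A = pt x].
Proof.
have [a [b ->]] := frame_point_surj O A c0.
move=> /arcE[ab1 h]; rewrite !inE !negb_or => /and4P[nP nQ nQ' nP'].
have [|x [aE bE]] := circle_param_surj ab1.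
  by apply: contraNneq nQ => -[-> ->].
move: h nP nQ' nP'; rewrite aE bE => {nQ ab1 aE bE}.
rewrite -subr_ge0 chord_height => h nP nQ' nP'.
have d0 := circ_den_gt0 x.
have ne c d : c * circ_den x = 4 * x ^+ 2 - 2 * x ->
    d * circ_den x = 3 * x ^+ 2 - 4 * x + 1 -> pt x = frame_point O e f c d.
  by move=> k l; have [-> ->] := circ_xyP k l.
have x0 : x != 0.
  apply: contraNneq nQ' => xE; apply/eqP/ne; rewrite xE /circ_den; lra.
have x1 : x - 1 != 0.
  rewrite subr_eq0; apply: contraNneq nP => xE; apply/eqP/ne; rewrite xE /circ_den; lra.
have x5 : 5 * x - 1 != 0.
  rewrite subr_eq0; apply: contraNneq nP' => k; have xE : x = 5^-1 by lra.
  by apply/eqP/ne; rewrite xE /circ_den; field.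
have [|y [z [Exyz n0]]] := bary_cubic_split x0.
  rewrite lt_neqAle eq_sym mulf_neq0 //=.
  by move: h; rewrite pmulr_lge0 ?invr_gt0.
by exists x, y, z.
Qed.

(** The other two vertices are on the arc because the curve is invariant under
    cyclic permutation of the coordinates. *)
Lemma param_unique_centroid_pair (x y z : R) :
  bary_cubic x y z -> x * y * z != 0 ->
  unique_centroid_pair arc (frame_point O e f (1 / 3) (2 / 3)) (pt x) (pt y) (pt z).
Proof.
move=> Exyz n0; have [sx sy _ _] := bary_cubic_sums Exyz.
have nyzx : y * z * x != 0 by rewrite mulrC mulrA.
have nzxy : z * x * y != 0 by rewrite -mulrA mulrC.
have [arcY _] := param_arc (bary_cubic_cycle Exyz) nyzx.
have [arcZ _] := param_arc (bary_cubic_cycle (bary_cubic_cycle Exyz)) nzxy.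
split=> //; first by rewrite centroid_frame sx sy.
move=> Y' Z'.
have [u1 [u2 ->]] := frame_point_surj O Y' c0.
have [v1 [v2 ->]] := frame_point_surj O Z' c0.
move=> /arcE[hu _] /arcE[hv _]; rewrite centroid_frame.
move=> /(frame_point_inj c0)[s1 s2].
(* If the sum were zero, the remaining vertex would be [(1, 2)], off the circle. *)
have yz0 : (circ_x y + circ_x z, circ_y y + circ_y z) != (0, 0).
  apply/eqP => -[k1 k2]; have := on_unit_circle x.
  have -> : circ_x x = 1 by lra.
  have -> : circ_y x = 2 by lra.
  by lra.
have t1 : u1 + v1 = circ_x y + circ_x z by lra.
have t2 : u2 + v2 = circ_y y + circ_y z by lra.
have := unit_pair_unique (on_unit_circle y) (on_unit_circle z) hu hv t1 t2 yz0.
by case=> -[-> -> -> ->]; [left|right].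
Qed.

Lemma param_triangle (x y z : R) : bary_cubic x y z -> x * y * z != 0 ->
  triangle (pt x) (pt y) (pt z).
Proof.
move=> Exyz n0; have nyzx : y * z * x != 0 by rewrite mulrC mulrA.
have nzxy : z * x * y != 0 by rewrite -mulrA mulrC.
have yz := bary_cubic_neq Exyz n0.
have zx := bary_cubic_neq (bary_cubic_cycle Exyz) nyzx.
have xy := bary_cubic_neq (bary_cubic_cycle (bary_cubic_cycle Exyz)) nzxy.
rewrite /triangle orient_frame circle_param_det mulf_neq0 //.
by rewrite !mulf_neq0 ?invr_eq0 ?mulf_neq0 ?circ_den_neq0 ?subr_eq0 ?pnatr_eq0.
Qed.

Lemma param_bary (x y z : R) : bary_cubic x y z ->
  x *: pt x + y *: pt y + z *: pt z = frame_point O e f 1 0.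
Proof.
move=> Exyz; have [_ _ px py] := bary_cubic_sums Exyz; have [s1 _] := Exyz.
transitivity (frame_point ((x + y + z) *: O) e f
    (x * circ_x x + y * circ_x y + z * circ_x z)
    (x * circ_y x + y * circ_y y + z * circ_y z)).
  by apply: row2P; rewrite !mxE; ring.
by rewrite px py s1 scale1r.
Qed.

End FrameArc.

Theorem theorem3p6 (R : realType)
    (A B C : 'rV[R]_2) (hABC : triangle A B C)
    (Z1 : 'rV[R]_2) (r : R) (hr : 0 < r)
    (Q1 P1' O1 S1 G1 P1 Q1' : 'rV[R]_2)
    (hQ1 : circle Z1 r Q1) (hP1' : circle Z1 r P1')
    (hO1 : is_square Q1 Z1 P1' O1)
    (hS1 : S1 = midpoint Q1 O1)
    (hG1 : ppoint G1 = (pline Z1 S1 :&: pline Q1 P1')%VS)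
    (hP1 : P1 = reflection G1 Z1 P1')
    (hQ1' : Q1' = reflection G1 Z1 Q1)
    (arcA : set 'rV[R]_2) (harc : is_arc Z1 r P1 P1' arcA)
    (hQ1arc : arcA Q1) (hQ1'arc : arcA Q1') :
  (forall A1 : 'rV[R]_2, arcA A1 -> A1 \notin [:: P1; Q1; Q1'; P1'] ->
     exists B1 C1 : 'rV[R]_2, unique_centroid_pair arcA G1 A1 B1 C1) /\
  curveE A B C `\` [set ppoint A; ppoint B; ppoint C;
                        infinite_point B C; infinite_point A C;
                        infinite_point A B] =
  [set P : {vspace 'rV[R]_(2 + 1)} |
    exists (A1 B1 C1 : 'rV[R]_2) (f : 'rV[R]_2 -> 'rV[R]_2),
      [/\ arcA A1 /\ A1 \notin [:: P1; Q1; Q1'; P1'],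
          unique_centroid_pair arcA G1 A1 B1 C1,
          affine_map f,
          maps_triangle f A1 B1 C1 A B C \/ maps_triangle f A1 C1 B1 A B C
        & P = ppoint (f P1)]].
Proof.
subst S1.
have [e [f [oef [QE P'E GE PE Q'E]]]] := configuration_frame hr hQ1 hP1' hO1 hG1.
have c0 := frame_cross_neq0 hr oef.
rewrite -{}hP1 in PE; rewrite -{}hQ1' in Q'E.
subst Q1 P1' G1 P1 Q1'.
have arcE := arc_frame hr oef harc hQ1'arc.
split.
  move=> A1 arcA1 nA1; have [x [y [z [Exyz n0 ->]]]] := arc_param c0 arcE arcA1 nA1.
  by do 2!eexists; exact: (param_unique_centroid_pair c0 arcE Exyz n0).
rewrite curveE_affine_part //; apply/seteqP; split=> P /=.
  move=> [x [y [z [Exyz n0 ->]]]].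
  have tx := param_triangle Z1 c0 Exyz n0.
  have [g [affg mg]] := affine_map_exists tx hABC.
  do 3!eexists; exists g; split; [exact: (param_arc c0 arcE Exyz n0)
    |exact: (param_unique_centroid_pair c0 arcE Exyz n0)|done|by left|].
  have [s1 _] := Exyz; case: mg => <- <- <-.
  by rewrite -affine_bary // (param_bary Z1 e f Exyz).
move=> [A1 [B1 [C1 [g [[arcA1 nA1] [arcB1 arcC1 cenG _] affg mg ->]]]]].
have [x [y [z [Exyz n0 A1E]]]] := arc_param c0 arcE arcA1 nA1.
have [_ _ _ uniq] := param_unique_centroid_pair c0 arcE Exyz n0.
(* Uniqueness of the pair [B1, C1] identifies it with the parametrized one,
   possibly after an exchange. *)
have [y' [z' [Exyz' n0' A1E' B1E C1E]]] : exists y' z', [/\ bary_cubic x y' z',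
    x * y' * z' != 0, A1 = frame_point Z1 e f (circ_x x) (circ_y x),
    B1 = frame_point Z1 e f (circ_x y') (circ_y y') &
    C1 = frame_point Z1 e f (circ_x z') (circ_y z')].
  rewrite A1E in cenG.
  case: (uniq _ _ arcB1 arcC1 cenG) => -[-> ->]; first by exists y, z.
  by exists z, y; split=> //; [exact: bary_cubic_swap|rewrite mulrAC].
have [s1 _] := Exyz'.
rewrite -(param_bary Z1 e f Exyz') affine_bary // -A1E' -B1E -C1E.
(* Exchanging the images of [B1] and [C1] exchanges [y] and [z] on the curve. *)
case: mg => -[-> -> ->]; first by exists x, y', z'.
exists x, z', y'; split; [exact: bary_cubic_swap|by rewrite mulrAC|].
by rewrite addrAC.
Qed.
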